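(* Let $a,b,c$ be positive integers and let $Q_{a,b,c}$ be the quiver with vertices $1,2,3$, with $a$ arrows $1\to2$, $b$ arrows $2\to3$ and $c$ arrows $3\to1$. If at least one of $a,b,c$ equals $1$, then $Q_{a,b,c}$ has a maximal green sequence.
   Context: A quiver is a finite directed multigraph with no loops and no oriented 2-cycles. Mutation $\mu_k$: for every path $i\to k\to j$ add an arrow $i\to j$, reverse all arrows at $k$, delete a maximal collection of oriented 2-cycles (and arrows between frozen vertices). The framed quiver $\hat Q$ adds a frozen (never mutated) vertex $i'$ and an arrow $i\to i'$ for each vertex $i$. A non-frozen vertex is green if it has no incoming arrow from a frozen vertex and red if it has no outgoing arrow to a frozen vertex. $(i_1,\dots,i_l)$ is a maximal green sequence if each $i_t$ is green in $\mu_{i_{t-1}}\cdots\mu_{i_1}(\hat Q)$ and every non-frozen vertex of $\mu_{i_l}\cdots\mu_{i_1}(\hat Q)$ is red. *)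

(* Defs.v *)
From mathcomp Require Import all_boot.
Set Implicit Arguments. Unset Strict Implicit. Unset Printing Implicit Defensive.

(* A finite directed multigraph without loops or oriented 2-cycles, given by
   the number [arrows Q i j] of arrows i -> j. *)
Record quiver (V : finType) := Quiver {
  arrows :> V -> V -> nat;
  no_loop : forall i, arrows i i = 0;
  no_2cycle : forall i j, arrows i j = 0 \/ arrows j i = 0
}.

Section MutationSteps.
Variable V : finType.
Implicit Types A : V -> V -> nat.

Definition add_paths (k : V) A i j := A i j + A i k * A k j.

(* Applied after [add_paths] at the same k; this leaves the arrows at k
   untouched there, because a quiver has no loop at k. *)
Definition reverse_at (k : V) A i j :=
  if (i == k) || (j == k) then A j i else A i j.

(* A maximal collection of 2-cycles between i and j uses up
   min (A i j) (A j i) arrows in each direction. *)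
Definition delete_2cycles A i j := A i j - minn (A i j) (A j i).

Lemma delete_2cycles_loop A i : delete_2cycles A i i = 0.
Proof. by rewrite /delete_2cycles minnn subnn. Qed.

Lemma delete_2cyclesP A i j :
  delete_2cycles A i j = 0 \/ delete_2cycles A j i = 0.
Proof.
rewrite /delete_2cycles; case: leqP => _; first by left; rewrite subnn.
by right; rewrite subnn.
Qed.

End MutationSteps.

(* A quiver with mutable vertices M and frozen vertices F is a quiver on M + F;
   only vertices of M can be mutated. *)
Section IceQuiver.
Variables M F : finType.
Implicit Types (Q : quiver (M + F)%type) (k : M) (s : seq M).

Definition delete_frozen (A : (M + F)%type -> (M + F)%type -> nat) i j :=
  match i, j with inr _, inr _ => 0 | _, _ => A i j end.

Definition mutation_arrows k Q : (M + F)%type -> (M + F)%type -> nat :=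
  delete_frozen (delete_2cycles (reverse_at (inl k) (add_paths (inl k) Q))).

Lemma mutation_no_loop k Q i : mutation_arrows k Q i i = 0.
Proof. by case: i => // i; apply: delete_2cycles_loop. Qed.

Lemma mutation_no_2cycle k Q i j :
  mutation_arrows k Q i j = 0 \/ mutation_arrows k Q j i = 0.
Proof. by case: i j => i [] j; [..|left]; try exact: delete_2cyclesP. Qed.

Definition mutation k Q : quiver (M + F)%type :=
  Quiver (mutation_no_loop k Q) (mutation_no_2cycle k Q).

(* [mutations Q [:: i1; ...; il]] is mu_il (... (mu_i1 Q)). *)
Definition mutations Q s := foldl (fun Q' k => mutation k Q') Q s.

Definition green Q (i : M) := forall f : F, Q (inr f) (inl i) = 0.
Definition red Q (i : M) := forall f : F, Q (inl i) (inr f) = 0.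

End IceQuiver.

Section Framed.
Variables (V : finType) (Q : quiver V).

(* [inr i] is the frozen copy i' of the vertex [inl i]. *)
Definition framed_arrows (x y : (V + V)%type) : nat :=
  match x, y with
  | inl i, inl j => Q i j
  | inl i, inr j => (i == j) : nat
  | inr _, _ => 0
  end.

Lemma framed_no_loop x : framed_arrows x x = 0.
Proof. by case: x => //= i; apply: no_loop. Qed.

Lemma framed_no_2cycle x y : framed_arrows x y = 0 \/ framed_arrows y x = 0.
Proof. by case: x y => i [] j /=; [apply: no_2cycle|right|left|left]. Qed.

Definition framed : quiver (V + V)%type :=
  Quiver framed_no_loop framed_no_2cycle.

Definition maximal_green_sequence (s : seq V) : Prop :=
  (forall s1 i s2, s = s1 ++ i :: s2 -> green (mutations framed s1) i) /\
  (forall i, red (mutations framed s) i).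

End Framed.

Section ThreeVertices.
Variables a b c : nat.

(* The vertices 1, 2, 3 are the elements 0, 1, 2 of 'I_3. *)
Definition cyc3_arrows (i j : 'I_3) : nat :=
  match val i, val j with
  | 0, 1 => a
  | 1, 2 => b
  | 2, 0 => c
  | _, _ => 0
  end.

Lemma cyc3_no_loop i : cyc3_arrows i i = 0.
Proof. by case: i => [[|[|[|i]]]]. Qed.

Lemma cyc3_no_2cycle i j : cyc3_arrows i j = 0 \/ cyc3_arrows j i = 0.
Proof.
by case: i j => [[|[|[|i]]] Hi] [[|[|[|j]]] Hj]; by [left|right].
Qed.

Definition cyc3 : quiver 'I_3 := Quiver cyc3_no_loop cyc3_no_2cycle.

End ThreeVertices.

(* Main.v *)
Require Import Defs.
From mathcomp Require Import all_boot.
From mathcomp Require Import zify.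
Set Implicit Arguments. Unset Strict Implicit. Unset Printing Implicit Defensive.

(** By rotation we may assume a = 1. Then 2, 3, 1, 2 is a maximal green sequence
    when b <= c and 2, 1, 3, 2 is one when c <= b: after mutating at 2 there
    are b - c arrows 1 -> 3 (counted with sign), so whichever of 1 and 3 is
    mutated first has no arrow from the other, and both orders lead to the
    same quiver. *)

Section Isomorphism.
Variables (V W : finType) (f : V -> W) (g : W -> V).
Hypotheses (fK : cancel f g) (gK : cancel g f).

Definition sum_map (x : V + V) : W + W :=
  match x with inl i => inl (f i) | inr i => inr (f i) end.

Lemma sum_map_inj : injective sum_map.
Proof. by move=> [i|i] [j|j] //= [/(can_inj fK)->]. Qed.

(** Mutation depends only on arrow counts, on equality with [k] and on which vertices are frozen;
    the injective map [sum_map] respects all three. *)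
Lemma mutation_iso (Q : quiver (V + V)%type) (R : quiver (W + W)%type) k :
  (forall x y, R (sum_map x) (sum_map y) = Q x y) ->
  forall x y, mutation (f k) R (sum_map x) (sum_map y) = mutation k Q x y.
Proof.
move=> RQ x y.
have E u v : reverse_at (inl (f k)) (add_paths (inl (f k)) R)
               (sum_map u) (sum_map v) =
             reverse_at (inl k) (add_paths (inl k) Q) u v.
  rewrite /reverse_at /add_paths -[inl (f k)]/(sum_map (inl k)).
  by rewrite !RQ !(inj_eq sum_map_inj).
rewrite /= /mutation_arrows.
by case: x y => [i|i] [j|j] //=; rewrite /delete_2cycles -!E.
Qed.

Lemma mutations_iso (Q : quiver (V + V)%type) (R : quiver (W + W)%type) s :
  (forall x y, R (sum_map x) (sum_map y) = Q x y) ->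
  forall x y,
    mutations R (map f s) (sum_map x) (sum_map y) = mutations Q s x y.
Proof.
by elim: s Q R => [|k s IHs] Q R RQ //=; apply/IHs/mutation_iso.
Qed.

Lemma maximal_green_sequence_iso (Q : quiver V) (R : quiver W) s :
  (forall i j, R (f i) (f j) = Q i j) ->
  maximal_green_sequence Q s -> maximal_green_sequence R (map f s).
Proof.
move=> RQ [greenQ redQ].
have RQs t := @mutations_iso (framed Q) (framed R) t _.
have {}RQs t x y : mutations (framed R) (map f t) (sum_map x) (sum_map y) =
                   mutations (framed Q) t x y.
  apply: RQs => -[i|i] [j|j] //=.
  by rewrite (inj_eq (can_inj fK)).
split=> [t1 i t2 def_s j | i j]; last first.
  by have := RQs s (inl (g i)) (inr (g j)); rewrite /= !gK => ->; apply: redQ.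
(* As [g] inverts [f], a prefix of [map f s] is the image of a prefix of [s], where greenness is
   known. *)
have def_t1 : t1 = map f (map g t1) by rewrite mapK.
have := RQs (map g t1) (inr (g j)) (inl (g i)); rewrite /= !gK -def_t1 => ->.
apply: (greenQ _ _ (map g t2)).
by rewrite -[s](mapK fK) def_s map_cat.
Qed.

End Isomorphism.

(* Rows and columns are listed in the order 1, 2, 3, 1', 2', 3'; missing
   entries are 0. *)
Definition table (T : seq (seq nat)) (x y : 'I_3 + 'I_3) : nat :=
  let idx z := match z with inl i => val i | inr i => 3 + val i end in
  nth 0 (nth [::] T (idx x)) (idx y).

(** Mutation reads only arrow counts, so pointwise agreement with a table suffices to compute the
    next one. *)
Lemma mutation_table T T' k (Q : quiver ('I_3 + 'I_3)%type) :
  Q =2 table T ->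
  delete_frozen
    (delete_2cycles (reverse_at (inl k) (add_paths (inl k) (table T))))
    =2 table T' ->
  mutation k Q =2 table T'.
Proof.
move=> QT TT' x y; rewrite -TT' /= /mutation_arrows.
by case: x y => [i|i] [j|j] //=;
  rewrite /delete_2cycles /reverse_at /add_paths !QT.
Qed.

Section SingleArrow.
Variables b c : nat.

Let v1 : 'I_3 := @Ordinal 3 0 isT.
Let v2 : 'I_3 := @Ordinal 3 1 isT.
Let v3 : 'I_3 := @Ordinal 3 2 isT.

Let Q0 := framed (cyc3 1 b c).

Let T0 :=
  [:: [:: 0; 1; 0; 1; 0; 0]; [:: 0; 0; b; 0; 1; 0]; [:: c; 0; 0; 0; 0; 1]].
(** Subtraction is truncated: the entries [b - c] and [c - b] together encode a signed number of
    arrows, and at most one is nonzero. *)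
Let T2 :=
  [:: [:: 0; 0; b - c; 1; 1; 0]; [:: 1]; [:: c - b; b; 0; 0; 0; 1];
      [::]; [:: 0; 1]].
Let T23 :=
  [:: [:: 0; 0; c - b; 1; 1; 0]; [:: 1; 0; b]; [:: b - c];
      [::]; [:: 0; 1]; [:: 0; 0; 1]].
Let T21 :=
  [:: [:: 0; 1; c - b]; [:: 0; 0; 0; 1; 0; 0]; [:: b - c; c; 0; 0; 0; 1];
      [:: 1]; [:: 1]].
Let T231 :=
  [:: [:: 0; 1; b - c]; [:: 0; 0; c; 1; 0; 0]; [:: c - b];
      [:: 1]; [:: 1]; [:: 0; 0; 1]].
Let T2312 :=
  [:: [:: 0; 0; b]; [:: 1]; [:: 0; c];
      [:: 0; 1]; [:: 1]; [:: 0; 0; 1]].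

Ltac compute_table :=
  move=> [[[|[|[|?]]] ?]|[[|[|[|?]]] ?]] [[[|[|[|?]]] ?]|[[|[|[|?]]] ?]] //;
  rewrite /table /delete_2cycles /reverse_at /add_paths /=; lia.

Lemma framed_table : Q0 =2 table T0.
Proof.
by move=> [[[|[|[|?]]] ?]|[[|[|[|?]]] ?]] [[[|[|[|?]]] ?]|[[|[|[|?]]] ?]].
Qed.

Lemma mutations2 : mutations Q0 [:: v2] =2 table T2.
Proof. by apply: mutation_table framed_table _; compute_table. Qed.

(** Here [b - c] is 0, so no arrow enters 3 and the mutation only reverses arrows. *)
Lemma mutations23 : b <= c -> mutations Q0 [:: v2; v3] =2 table T23.
Proof.
by move=> le_bc; apply: mutation_table mutations2 _; compute_table.
Qed.

(** The paths 2 -> 1 -> 3 cancel [b - c] of the [b] arrows 3 -> 2, leaving [c]. *)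
Lemma mutations21 : c <= b -> mutations Q0 [:: v2; v1] =2 table T21.
Proof.
by move=> le_cb; apply: mutation_table mutations2 _; compute_table.
Qed.

Lemma mutations231 : b <= c -> mutations Q0 [:: v2; v3; v1] =2 table T231.
Proof.
by move=> le_bc; apply: mutation_table (mutations23 le_bc) _; compute_table.
Qed.

Lemma mutations213 : c <= b -> mutations Q0 [:: v2; v1; v3] =2 table T231.
Proof.
by move=> le_cb; apply: mutation_table (mutations21 le_cb) _; compute_table.
Qed.

(** The [c] paths 1 -> 2 -> 3 turn the signed count b - c of arrows 1 -> 3 into [b], whichever of
    [b] and [c] is larger. *)
Lemma mutations_last s :
  mutations Q0 s =2 table T231 -> mutations Q0 (rcons s v2) =2 table T2312.
Proof.
rewrite /mutations foldl_rcons => sT.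
by apply: mutation_table sT _; compute_table.
Qed.

Lemma red_last s i :
  mutations Q0 s =2 table T231 -> red (mutations Q0 (rcons s v2)) i.
Proof.
move=> /mutations_last sT j; rewrite sT.
by case: i j => [[|[|[|?]]] ?] [[|[|[|?]]] ?].
Qed.

Lemma green_table (Q : quiver ('I_3 + 'I_3)%type) T i :
  Q =2 table T -> (forall j, table T (inr j) (inl i) = 0) -> green Q i.
Proof. by move=> QT Ti j; rewrite QT. Qed.

Ltac table_green H := apply: green_table H _ => -[[|[|[|?]]] ?].

Lemma maximal_green_sequence_single_arrow :
  exists s, maximal_green_sequence (cyc3 1 b c) s.
Proof.
case: (leqP b c) => [le_bc | /ltnW le_cb].
- exists [:: v2; v3; v1; v2]; split=> [|i]; last first.
    exact: (red_last _ (mutations231 le_bc)).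
  (* Split on the length of the prefix: the empty one is settled by the framing, and lengths above 3
     are impossible. *)
  move=> [|? [|? [|? [|? [|? ?]]]]] i s2 //= [].
  + by move=> <- <- _; table_green mutations2.
  + by move=> <- <- <- _; table_green (mutations23 le_bc).
  + by move=> <- <- <- <- _; table_green (mutations231 le_bc).
- exists [:: v2; v1; v3; v2]; split=> [|i]; last first.
    exact: (red_last _ (mutations213 le_cb)).
  move=> [|? [|? [|? [|? [|? ?]]]]] i s2 //= [].
  + by move=> <- <- _; table_green mutations2.
  + by move=> <- <- <- _; table_green (mutations21 le_cb).
  + by move=> <- <- <- <- _; table_green (mutations213 le_cb).
Qed.

End SingleArrow.

(** The cyclic shift [ordS] of the vertices sends 1 -> 2, 2 -> 3, 3 -> 1 to 2 -> 3, 3 -> 1, 1 ->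
    2. *)
Lemma maximal_green_sequence_rotate a b c :
  (exists s, maximal_green_sequence (cyc3 a b c) s) ->
  exists s, maximal_green_sequence (cyc3 c a b) s.
Proof.
case=> s mgs_s; exists (map (@ordS 3) s).
apply: (maximal_green_sequence_iso (@ordSK 3) (@ord_predK 3)) mgs_s.
by move=> [[|[|[|?]]] ?] [[|[|[|?]]] ?].
Qed.

Theorem theorem5p2 (a b c : nat) (ha : 0 < a) (hb : 0 < b) (hc : 0 < c)
  (h1 : a = 1 \/ b = 1 \/ c = 1) :
  exists s : seq 'I_3, maximal_green_sequence (cyc3 a b c) s.
Proof.
case: h1 => [->|[->|->]].
- exact: maximal_green_sequence_single_arrow.
(* One rotation moves the multiplicity 1 from first to second place, two move it to third. *)
- exact/maximal_green_sequence_rotate/maximal_green_sequence_single_arrow.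
- do 2!apply: maximal_green_sequence_rotate.
  exact: maximal_green_sequence_single_arrow.
Qed.
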